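(* Let $n\ge2$. For every $0\le k\le n$ we have $QS^k_n=P^k_n$ as polynomials in $X_1,\dots,X_n,Q_1,\dots,Q_n$.
   Context: Let $X_1,\dots,X_n,Q_1,\dots,Q_n$ be indeterminates, and let $\mu,z$ be further indeterminates. Put $S_n=(X_1+\mu)(X_2+\mu)\cdots(X_n+\mu)$, $D_i=\mathrm{Id}+Q_i\frac{\partial^2}{\partial X_i\partial X_{i+1}}$ for $i\in\mathbb{Z}/n\mathbb{Z}$ (so $X_{n+1}=X_1$), and define the polynomials $QS^i_n$ by $$QS_n=\sum_{i=0}^nQS^i_n\,\mu^i=D_nD_{n-1}\cdots D_1S_n .$$ Let $\mathcal{L}_n$ be the $n\times n$ Lax matrix of the periodic one-dimensional Toda lattice: it has diagonal entries $X_1,\dots,X_n$; entries $Q_i$ in position $(i,i+1)$ and $-1$ in position $(i+1,i)$ for $1\le i\le n-1$; entry $-z$ in position $(1,n)$ and entry $Q_n/z$ in position $(n,1)$; all other entries are $0$ (for $n=2$ entries in the same position are added). The polynomials $P^i_n,A_n,B_n$ in $X_1,\dots,X_n,Q_1,\dots,Q_n$ are defined by $$\det(\mathcal{L}_n+\mu I)=P_n=\sum_{i=0}^nP^i_n\,\mu^i+A_n\frac1z+B_nz .$$ The polynomials $P^0_n,\dots,P^{n-1}_n$ are the conserved quantities of the periodic Toda lattice. *)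

(* Defs.v *)
From mathcomp Require Import all_boot all_order all_algebra.
From mathcomp Require Import mpoly.

Set Implicit Arguments.
Unset Strict Implicit.
Unset Printing Implicit Defensive.

Import GRing.Theory.
Local Open Scope ring_scope.

(* Variables of R[X_1,...,X_n,Q_1,...,Q_n]; both families are indexed from 0. *)
Definition varX (R : idomainType) (n : nat) (i : 'I_n) : {mpoly R[n + n]} :=
  'X_(lshift n i).

Definition varQ (R : idomainType) (n : nat) (i : 'I_n) : {mpoly R[n + n]} :=
  'X_(rshift n i).

(* In {poly {mpoly R[n + n]}} the polynomial variable 'X is mu. *)
Definition Smu (R : idomainType) (n : nat) : {poly {mpoly R[n + n]}} :=
  \prod_(i < n) ((varX R i)%:P + 'X).

(* The partial derivatives act coefficientwise in mu; [ordS i] is i + 1 mod n. *)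
Definition opD (R : idomainType) (n : nat) (i : 'I_n)
    (p : {poly {mpoly R[n + n]}}) : {poly {mpoly R[n + n]}} :=
  p + (varQ R i)%:P *
      map_poly (fun c => mderiv (lshift n i) (mderiv (lshift n (ordS i)) c)) p.

(* The operator of smallest index is applied first. *)
Definition QS (R : idomainType) (n : nat) : {poly {mpoly R[n + n]}} :=
  foldl (fun p i => opD i p) (Smu R n) (enum 'I_n).

(* Fractions in z over R[X,Q], which contain the Laurent polynomials in z. *)
Definition zfrac (R : idomainType) (n : nat) :=
  {fraction {poly {mpoly R[n + n]}}}.

Definition inj (R : idomainType) (n : nat) (c : {mpoly R[n + n]}) :
    zfrac R n := tofrac c%:P.

Definition zvar (R : idomainType) (n : nat) : zfrac R n := tofrac 'X.

(* The summands have disjoint supports unless n <= 2. *)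
Definition Lax (R : idomainType) (n : nat) : 'M[zfrac R n]_n :=
  \matrix_(i, j)
    (inj (varX R i) *+ (i == j)
     + inj (varQ R i) *+ (j == i.+1 :> nat)
     + (-1) *+ (i == j.+1 :> nat)
     + (- zvar R n) *+ ((i == 0%N :> nat) && (j == n.-1 :> nat))
     + (inj (varQ R i) / zvar R n) *+ ((i == n.-1 :> nat) && (j == 0%N :> nat))).

(* As for [char_poly], the variable 'X of {poly zfrac R n} is mu. *)
Definition Lax_expansion (R : idomainType) (n : nat)
    (P : 'I_n.+1 -> {mpoly R[n + n]}) (A B : {mpoly R[n + n]}) : Prop :=
  \det (map_mx polyC (Lax R n) + 'X%:M) =
    \sum_(i < n.+1) (inj (P i))%:P * 'X^i
    + (inj A / zvar R n)%:P + (inj B * zvar R n)%:P.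

(* Main.v *)
Require Import Defs.
From mathcomp Require Import all_boot all_order all_algebra.
From mathcomp Require Import mpoly.
From mathcomp Require Import zify ring.

(* Write x_i = X_i + mu and let K(i..j) be the continuant of x_i, ..., x_j with
   links Q_i, ..., Q_(j-1): this is the determinant of the tridiagonal part of
   the Lax matrix restricted to the rows i..j.  Multilinearity in the two
   corner entries gives
     det (L_n + mu) = K(1..n) + Q_n K(2..n-1) + A / z - z,
   where A is a signed product of all the Q_i.  On the other side, the
   derivative of K(i..j) by x_j (resp. x_i) is K(i..j-1) (resp. K(i+1..j)), so
   by the recurrence of continuants D_m ... D_1 turns S_n into
   K(1..m+1) x_(m+2) ... x_n for m < n, and the last operator D_n adds
   Q_n K(2..n-1). *)

Set Implicit Arguments.
Unset Strict Implicit.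
Unset Printing Implicit Defensive.

Import GRing.Theory.
Local Open Scope ring_scope.

(** * Continuants *)

Fixpoint continuant (A : nzRingType) (x q : nat -> A) (n : nat) : A :=
  match n with
  | 0 => 1
  | (m.+1 as n').+1 => x n' * continuant x q n' + q m * continuant x q m
  | 1 => x 0
  end.

Arguments continuant : simpl never.

Lemma continuantSS (A : nzRingType) (x q : nat -> A) n :
  continuant x q n.+2 =
    x n.+1 * continuant x q n.+1 + q n * continuant x q n.
Proof. by []. Qed.

Lemma rmorph_continuant (A B : nzRingType) (f : {rmorphism A -> B})
    (x q : nat -> A) n :
  f (continuant x q n) = continuant (f \o x) (f \o q) n.
Proof.
(* The recurrence reaches back two steps, so the induction carries two consecutive indices. *)
suff: f (continuant x q n) = continuant (f \o x) (f \o q) n /\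
      f (continuant x q n.+1) = continuant (f \o x) (f \o q) n.+1 by case.
elim: n => [|n [IH1 IH2]]; first by split=> //; rewrite /continuant rmorph1.
by split=> //; rewrite !continuantSS rmorphD !rmorphM IH1 IH2.
Qed.

Lemma eq_continuant (A : nzRingType) (x y q r : nat -> A) n :
  x =1 y -> q =1 r -> continuant x q n = continuant y r n.
Proof.
move=> exy eqr.
suff: continuant x q n = continuant y r n /\
      continuant x q n.+1 = continuant y r n.+1 by case.
elim: n => [|n [IH1 IH2]]; first by split; last exact: exy.
by split=> //; rewrite !continuantSS exy eqr IH1 IH2.
Qed.

Lemma size_continuant (A : idomainType) (x q : nat -> {poly A}) n :
  (forall i, size (x i) <= 2)%N -> (forall i, size (q i) <= 1)%N ->
  (size (continuant x q n) <= n.+1)%N.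
Proof.
move=> sx sq.
suff: (size (continuant x q n) <= n.+1)%N /\
      (size (continuant x q n.+1) <= n.+2)%N by case.
elim: n => [|n [IH1 IH2]]; first by split; rewrite ?size_poly1 ?sx.
split=> //; rewrite continuantSS.
apply: leq_trans (size_polyD _ _) _; rewrite geq_max.
apply/andP; split; apply: leq_trans (size_polyMleq _ _) _.
  by have := leq_add (sx n.+1) IH2; case: (_ + _)%N.
by have := leq_add (sq n) IH1; case: (_ + _)%N => // k; lia.
Qed.

(** * Tridiagonal and cyclic tridiagonal determinants *)

Definition tridiag (A : nzRingType) (x q : nat -> A) (i j : nat) : A :=
  x i *+ (i == j) + q i *+ (j == i.+1) + (-1) *+ (i == j.+1).

Lemma tridiag0 (A : nzRingType) (x q : nat -> A) i j :
  i != j -> j != i.+1 -> i != j.+1 -> tridiag x q i j = 0.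
Proof. by rewrite /tridiag => /negPf-> /negPf-> /negPf->; rewrite !addr0. Qed.

Lemma tridiag_diag (A : nzRingType) (x q : nat -> A) i :
  tridiag x q i i = x i.
Proof. by rewrite /tridiag eqxx ltn_eqF // !addr0. Qed.

Lemma tridiag_super (A : nzRingType) (x q : nat -> A) i :
  tridiag x q i i.+1 = q i.
Proof.
by rewrite /tridiag eqxx (ltn_eqF (ltnSn i)) ltn_eqF ?add0r ?addr0 //; lia.
Qed.

Lemma tridiag_sub (A : nzRingType) (x q : nat -> A) i :
  tridiag x q i.+1 i = -1.
Proof.
by rewrite /tridiag eqxx (gtn_eqF (ltnSn i)) ltn_eqF ?add0r //; lia.
Qed.

Lemma tridiagSS (A : nzRingType) (x q : nat -> A) i j :
  tridiag x q i.+1 j.+1 = tridiag (x \o S) (q \o S) i j.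
Proof. by rewrite /tridiag !eqSS. Qed.

Lemma eq_det (A : comNzRingType) n (f g : nat -> nat -> A) :
  (forall i j, (i < n)%N -> (j < n)%N -> f i j = g i j) ->
  \det (\matrix_(i < n, j < n) f i j) = \det (\matrix_(i < n, j < n) g i j).
Proof.
by move=> fg; congr (\det _); apply/matrixP => i j; rewrite !mxE; apply: fg.
Qed.

(** With entries given by a function on [nat], deleting a border row or column is at most a shift of
    arguments and needs no cast between ordinals. *)
Lemma cofactor_max_max (A : comNzRingType) n (f : nat -> nat -> A) :
  cofactor (\matrix_(i < n.+1, j < n.+1) f i j) ord_max ord_max =
    \det (\matrix_(i < n, j < n) f i j).
Proof.
rewrite /cofactor /= addnn -mul2n exprM sqrrN !expr1n mul1r.
by congr (\det _); apply/matrixP => i j; rewrite !mxE !lift_max.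
Qed.

Lemma cofactor_max_0 (A : comNzRingType) n (f : nat -> nat -> A) :
  cofactor (\matrix_(i < n.+1, j < n.+1) f i j) ord_max ord0 =
    (-1) ^+ n * \det (\matrix_(i < n, j < n) f i j.+1).
Proof.
rewrite /cofactor /= addn0; congr (_ * \det _).
by apply/matrixP => i j; rewrite !mxE lift_max lift0.
Qed.

Lemma cofactor_0_max (A : comNzRingType) n (f : nat -> nat -> A) :
  cofactor (\matrix_(i < n.+1, j < n.+1) f i j) ord0 ord_max =
    (-1) ^+ n * \det (\matrix_(i < n, j < n) f i.+1 j).
Proof.
rewrite /cofactor /= add0n; congr (_ * \det _).
by apply/matrixP => i j; rewrite !mxE lift_max lift0.
Qed.

(** A determinant is affine in each entry: the cofactors along row [r] delete that row, so they do
    not see the added [c]. *)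
Lemma det_add_entry (A : comNzRingType) n (f : nat -> nat -> A)
    (r s : 'I_n) c :
  \det (\matrix_(i < n, j < n) (f i j + c *+ ((i == r) && (j == s)))) =
  \det (\matrix_(i < n, j < n) f i j) +
    c * cofactor (\matrix_(i < n, j < n) f i j) r s.
Proof.
rewrite !(expand_det_row _ r) [in RHS](bigD1 s) //= [in LHS](bigD1 s) //=.
have cof j : cofactor (\matrix_(i < n, j < n)
    (f i j + c *+ ((i == r) && (j == s)))) r j =
    cofactor (\matrix_(i < n, j < n) f i j) r j.
  congr (_ * \det _); apply/matrixP => i k; rewrite !mxE.
  by rewrite [_ == r]eq_sym (negPf (neq_lift _ _)) addr0.
rewrite cof !mxE !eqxx mulrDl -!addrA; congr (_ + _); rewrite addrC.
congr (_ + _); apply: eq_bigr => j /negPf js.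
by rewrite cof !mxE js andbF addr0.
Qed.

Lemma det_tridiag (A : comNzRingType) (x q : nat -> A) n :
  \det (\matrix_(i < n, j < n) tridiag x q i j) = continuant x q n.
Proof.
suff: \det (\matrix_(i < n, j < n) tridiag x q i j) = continuant x q n /\
  \det (\matrix_(i < n.+1, j < n.+1) tridiag x q i j) = continuant x q n.+1
  by case.
elim: n => [|n [IH1 IH2]].
  by split; [rewrite det_mx00 | rewrite det_mx11 mxE tridiag_diag].
split=> //; rewrite (expand_det_row _ ord_max) big_ord_recr big_ord_recr /=.
rewrite big1 ?add0r => [|i _]; last first.
  by rewrite mxE tridiag0 ?mul0r //=; have := ltn_ord i; lia.
rewrite cofactor_max_max !mxE /= tridiag_diag tridiag_sub IH2 continuantSS addrC.
congr (_ + _).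
(* This cofactor has sign -1, which cancels the subdiagonal entry -1; hence the plus sign in the
   recurrence. The last column of its minor has [q n], in the last row, as its only nonzero
   entry. *)
rewrite /cofactor /= addSn addnn -mul2n exprS exprM sqrrN !expr1n mulr1 mulrA.
rewrite mulrNN !mul1r (expand_det_col _ ord_max) big_ord_recr /= big1 ?add0r.
  rewrite !mxE /= /bump ltnn leqnn add0n add1n tridiag_super /cofactor /=.
  rewrite addnn -mul2n exprM sqrrN !expr1n mul1r -IH1.
  congr (_ * \det _); apply/matrixP => i j; rewrite !mxE /= /bump.
  by congr (tridiag _ _ _ _); have := ltn_ord i; have := ltn_ord j; lia.
move=> i _; rewrite !mxE /= /bump.
by rewrite tridiag0 ?mul0r //; have := ltn_ord i; lia.
Qed.

(** This is the minor at the lower left corner: the superdiagonal becomes the diagonal of a lower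
    triangular matrix. *)
Lemma det_tridiag_trig (A : comNzRingType) (x q : nat -> A) n :
  \det (\matrix_(i < n, j < n) tridiag x q i j.+1) = \prod_(i < n) q i.
Proof.
rewrite det_trig; first by apply: eq_bigr => i _; rewrite mxE tridiag_super.
apply/is_trig_mxP => i j ij; rewrite mxE tridiag0 //; lia.
Qed.

(** This is the minor at the upper right corner: the entries -1 become the diagonal of an upper
    triangular matrix, whence the transpose. *)
Lemma det_tridiag_trigT (A : comNzRingType) (x q : nat -> A) n :
  \det (\matrix_(i < n, j < n) tridiag x q i.+1 j) = (-1) ^+ n.
Proof.
rewrite -det_tr det_trig.
  rewrite -[in RHS](card_ord n) -prodr_const.
  by apply: eq_bigr => i _; rewrite !mxE tridiag_sub.
apply/is_trig_mxP => i j ij; rewrite !mxE tridiag0 //; lia.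
Qed.

(* Expanding in the corner entries, the minor left by one of them alone is
   triangular up to the other corner; using both corners leaves rows 1..n. *)
Lemma det_cyclic_tridiag (A : comNzRingType) (x q : nat -> A) n u v :
  \det (\matrix_(i < n.+2, j < n.+2)
     (tridiag x q i j + u *+ ((i == 0%N :> nat) && (j == n.+1 :> nat))
      + v *+ ((i == n.+1 :> nat) && (j == 0%N :> nat)))) =
  continuant x q n.+2 - u * v * continuant (x \o S) (q \o S) n + u
    + (-1) ^+ n.+1 * v * \prod_(i < n.+1) q i.
Proof.
rewrite (det_add_entry (fun i j =>
  tridiag x q i j + u *+ ((i == 0%N) && (j == n.+1))) ord_max ord0).
rewrite (det_add_entry (tridiag x q) ord0 ord_max).
rewrite (cofactor_max_0 _ (fun i j =>
  tridiag x q i j + u *+ ((i == 0%N) && (j == n.+1)))).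
rewrite det_tridiag cofactor_0_max det_tridiag_trigT -exprD addnn.
rewrite (det_add_entry (fun i j => tridiag x q i j.+1) ord0 ord_max).
rewrite det_tridiag_trig (cofactor_0_max _ (fun i j => tridiag x q i j.+1)).
(* Signs meet in pairs: the cofactor sign of [u] against the entries -1 on the diagonal of its
   minor, and the two corner cofactors against each other, which leaves one factor -1 on [u * v]. *)
have sgn k : (-1) ^+ k.*2 = 1 :> A.
  by rewrite -mul2n exprM sqrrN !expr1n.
rewrite (eq_det (f := fun i j => tridiag x q i.+1 j.+1)
  (g := tridiag (x \o S) (q \o S))) => [|i j _ _]; last exact: tridiagSS.
rewrite det_tridiag sgn exprS.
have -> : forall c d : A, (-1) * (-1) ^+ n * (d + u * ((-1) ^+ n * c)) =
   (-1) * (-1) ^+ n * d - (-1) ^+ n.*2 * u * c.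
  by move=> c d; rewrite -addnn exprD; ring.
by rewrite sgn; ring.
Qed.

(** The z-free part common to both sides, for a lattice of n+2 sites: K(1..n) + Q_n K(2..n-1) in the
    usual indexing, as a polynomial in mu. *)
Definition cyclic_continuant (A : nzRingType) (x q : nat -> A) n : {poly A} :=
  let X i := (x i)%:P + 'X in let Q i := (q i)%:P in
  continuant X Q n.+2 + Q n.+1 * continuant (X \o S) (Q \o S) n.

Lemma map_cyclic_continuant (A B : nzRingType) (f : {rmorphism A -> B})
    (x q : nat -> A) n :
  map_poly f (cyclic_continuant x q n) = cyclic_continuant (f \o x) (f \o q) n.
Proof.
have fX i : map_poly f ((x i)%:P + 'X) = (f (x i))%:P + 'X.
  by rewrite rmorphD /= map_polyC map_polyX.
have fQ i : map_poly f (q i)%:P = (f (q i))%:P by rewrite map_polyC.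
rewrite rmorphD rmorphM !rmorph_continuant /= fQ.
by congr (_ + _ * _); apply: eq_continuant => i; rewrite /= ?fX ?fQ.
Qed.

(** The corners are [u = - z] and [v = q n.+1 / z]. Their product is free of z and yields the second
    term of the cyclic continuant, while [v] alone completes the product of all [q i]. *)
Lemma det_toda (K : fieldType) (x q : nat -> K) (z : K) n : z != 0 ->
  \det (map_mx polyC (\matrix_(i < n.+2, j < n.+2)
    (x i *+ (i == j) + q i *+ (j == i.+1 :> nat) + (-1) *+ (i == j.+1 :> nat)
     + (- z) *+ ((i == 0%N :> nat) && (j == n.+1 :> nat))
     + (q i / z) *+ ((i == n.+1 :> nat) && (j == 0%N :> nat)))) + 'X%:M) =
  cyclic_continuant x q n
    + ((-1) ^+ n.+1 * \prod_(i < n.+2) q i / z)%:P + (-1 * z)%:P.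
Proof.
move=> z0; rewrite /cyclic_continuant.
set X := fun i => (x i)%:P + 'X; set Q := fun i => (q i)%:P.
have -> : continuant X Q n.+2 + Q n.+1 * continuant (X \o S) (Q \o S) n
      + ((-1) ^+ n.+1 * \prod_(i < n.+2) q i / z)%:P + (-1 * z)%:P =
    continuant X Q n.+2
      - (- z)%:P * (q n.+1 / z)%:P * continuant (X \o S) (Q \o S) n
      + (- z)%:P + (-1) ^+ n.+1 * (q n.+1 / z)%:P * \prod_(i < n.+1) Q i.
  rewrite big_ord_recr /= -rmorph_prod /= -!polyCM.
  have -> : - z * (q n.+1 / z) = - q n.+1 by rewrite mulNr mulrC divfK.
  set P := \prod_(i < _) q i; set K' := continuant (_ \o _) _ _.
  have -> : (-1) ^+ n.+1 = ((-1) ^+ n.+1)%:P :> {poly K}.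
    by rewrite polyC_exp polyCN.
  rewrite -!polyCM -[(-1) ^+ _ * _ * P]mulrA [_ / z * P]mulrAC [q _ * P]mulrC mulrA.
  by rewrite mulN1r !polyCN /Q; ring.
rewrite -det_cyclic_tridiag; congr (\det _); apply/matrixP => i j.
rewrite !mxE /tridiag -[i == j]/(i == j :> nat) !polyCD !polyCMn polyCN mulrnDl.
(* The corner value must not depend on the row; it is nonzero only in row n+1. *)
have -> : (q i / z)%:P *+ ((i == n.+1 :> nat) && (j == 0%N :> nat)) =
  (q n.+1 / z)%:P *+ ((i == n.+1 :> nat) && (j == 0%N :> nat)).
  by case: eqP => // ->.
by ring.
Qed.

(** * Derivations applied to continuants *)

Definition derivation (A : nzRingType) (d : A -> A) : Prop :=
  {morph d : a b / a + b} /\ (forall a b, d (a * b) = d a * b + a * d b).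

Lemma derivation1 (A : nzRingType) (d : A -> A) : derivation d -> d 1 = 0.
Proof.
case=> _ /(_ 1 1); rewrite !mulr1 mul1r => /eqP.
by rewrite -subr_eq0 opprD addNKr oppr_eq0 => /eqP.
Qed.

Lemma derivation_prod0 (A : nzRingType) (d : A -> A) (I : eqType) (r : seq I)
    (F : I -> A) :
  derivation d -> {in r, forall i, d (F i) = 0} -> d (\prod_(i <- r) F i) = 0.
Proof.
move=> dd; elim: r => [|i r IHr] dF; first by rewrite big_nil derivation1.
rewrite big_cons dd.2 dF ?mem_head // mul0r add0r IHr ?mulr0 // => j jr.
by rewrite dF // in_cons jr orbT.
Qed.

Lemma derivation_continuant0 (A : nzRingType) (d : A -> A) (x q : nat -> A) n :
  derivation d -> (forall i, (i < n)%N -> d (x i) = 0) ->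
  (forall i, (i.+1 < n)%N -> d (q i) = 0) -> d (continuant x q n) = 0.
Proof.
move=> dd; elim/ltn_ind: n => -[|[|n]] IHn dx dq; first exact: derivation1.
  exact: dx.
rewrite continuantSS dd.1 !dd.2 dx // dq // !mul0r !add0r.
by rewrite !IHn ?mulr0 ?addr0 // => i ilt; (apply: dx || apply: dq); lia.
Qed.

Lemma derivation_continuant_last (A : nzRingType) (d : A -> A)
    (x q : nat -> A) n :
  derivation d -> d (x n) = 1 -> (forall i, (i < n)%N -> d (x i) = 0) ->
  (forall i, (i < n)%N -> d (q i) = 0) ->
  d (continuant x q n.+1) = continuant x q n.
Proof.
case: n => [|n] dd dxn dx dq; first by [].
rewrite continuantSS dd.1 !dd.2 dxn mul1r dq // mul0r add0r.
by rewrite !derivation_continuant0 ?mulr0 ?addr0 // => i ilt;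
  (apply: dx || apply: dq); lia.
Qed.

(** The recurrence acts at the far end, so differentiating by the first variable commutes with it
    and both sides obey the same recurrence. *)
Lemma derivation_continuant_first (A : nzRingType) (d : A -> A)
    (x q : nat -> A) n :
  derivation d -> d (x 0%N) = 1 -> (forall i, (0 < i <= n)%N -> d (x i) = 0) ->
  (forall i, (i < n)%N -> d (q i) = 0) ->
  d (continuant x q n.+1) = continuant (x \o S) (q \o S) n.
Proof.
move=> dd dx0; elim/ltn_ind: n => -[|n] // IHn dx dq.
rewrite continuantSS dd.1 !dd.2 dx ?ltnSn // dq // !mul0r !add0r.
rewrite IHn // => [|i ilt|i ilt]; [|by apply: dx; lia|by apply: dq; lia].
(* For two sites the shorter continuant is 1, which does not contain [x 0]; the induction hypothesis
   does not cover it. *)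
case: n IHn dx dq => [|n] IHn dx dq.
  by rewrite (derivation1 dd) mulr0 addr0 /continuant /= mulr1.
by rewrite IHn // => i ilt; (apply: dx || apply: dq); lia.
Qed.

(** * The operators D_i applied to the product of the x_i *)

Section IteratedOperators.

Variables (A : comNzRingType) (x q : nat -> A) (d : nat -> A -> A) (n : nat).
Hypothesis dd : forall i, derivation (d i).
Hypothesis dx : forall i j, (i < n.+2)%N -> (j < n.+2)%N ->
  d i (x j) = (i == j)%:R.
Hypothesis dq : forall i j, d i (q j) = 0.
(** Indices are natural numbers; this is the wrap-around, needed by the last operator [D n.+1]. *)
Hypothesis d_cyclic : d n.+2 =1 d 0.

Let D p i := p + q i * d i (d i.+1 p).

(** In [D m], [d m.+1] strips [x m.+1] from the tail and [d m] shortens the continuant by one; the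
    correction term is then exactly the one in the recurrence of continuants. *)
Lemma foldl_prod_continuant m : (m < n.+2)%N ->
  foldl D (\prod_(0 <= i < n.+2) x i) (iota 0 m) =
    continuant x q m.+1 * \prod_(m.+1 <= i < n.+2) x i.
Proof.
elim: m => [|m IHm] lt_m; first by rewrite big_nat_recl // big_add1.
rewrite -[in iota 0 _]addn1 iotaD foldl_cat IHm ?(ltnW lt_m) //= /D add0n.
rewrite (big_ltn lt_m) continuantSS.
have d_tail k : (k < m.+2)%N -> d k (\prod_(m.+2 <= i < n.+2) x i) = 0.
  move=> lt_k; apply: derivation_prod0 => // i; rewrite mem_index_iota => /andP[].
  by move=> mi i_n; rewrite dx //; [case: eqP => //; lia | lia].
have dK : d m.+1 (continuant x q m.+1) = 0.
  apply: derivation_continuant0 => // i im.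
  by rewrite dx //; [case: eqP => //; lia | lia].
rewrite (dd m.+1).2 dK mul0r add0r (dd m.+1).2 dx // eqxx mul1r d_tail //.
rewrite mulr0 addr0.
rewrite (dd m).2 d_tail ?mulr0 ?addr0; last by lia.
rewrite derivation_continuant_last //; first by ring.
  by rewrite dx ?eqxx //; lia.
by move=> i im; rewrite dx //; [case: eqP => //; lia | lia | lia].
Qed.

Lemma foldl_prod_cyclic_continuant :
  foldl D (\prod_(0 <= i < n.+2) x i) (iota 0 n.+2) =
    continuant x q n.+2 + q n.+1 * continuant (x \o S) (q \o S) n.
Proof.
rewrite -[in iota 0 _]addn1 iotaD foldl_cat foldl_prod_continuant //=.
rewrite big_geq // mulr1 /D add0n d_cyclic.
(* After the wrap-around the last operator differentiates by the first variable, then by the last,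
   removing both ends. *)
rewrite derivation_continuant_first // ?dx //; last first.
  by move=> i ilt; rewrite dx //; [case: eqP => //; lia | lia].
rewrite derivation_continuant_last //= ?dx ?eqxx //.
by move=> i ilt; rewrite dx //; [case: eqP => //; lia | lia].
Qed.

End IteratedOperators.

(** * The operators on polynomials in X, Q and mu *)

Definition dX (R : idomainType) (n i : nat) :
    {poly {mpoly R[n.+1 + n.+1]}} -> {poly {mpoly R[n.+1 + n.+1]}} :=
  map_poly (mderiv (lshift n.+1 (inord i))).

Definition muX (R : idomainType) (n i : nat) : {poly {mpoly R[n.+1 + n.+1]}} :=
  (varX R (inord i : 'I_n.+1))%:P + 'X.

Definition polQ (R : idomainType) (n i : nat) : {poly {mpoly R[n.+1 + n.+1]}} :=
  (varQ R (inord i : 'I_n.+1))%:P.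

Lemma mderiv_var (R : idomainType) (m : nat) (i j : 'I_m) :
  mderiv i ('X_j : {mpoly R[m]}) = (i == j)%:R.
Proof.
rewrite mderivX mnmE eq_sym; case: eqVneq => [->|_]; last by rewrite scale0r.
rewrite scale1r (_ : U_(j) - U_(j) = 0)%MM ?mpolyX0 //.
by apply/mnmP => k; rewrite !mnmE subnn.
Qed.

Lemma derivation_dX (R : idomainType) (n i : nat) : derivation (@dX R n i).
Proof.
split=> [a b|a b]; first exact: raddfD.
apply/polyP => k; rewrite coefD !coefM !coef_map /= coefM raddf_sum -big_split /=.
by apply: eq_bigr => j _; rewrite !coef_map /= mderivM.
Qed.

Lemma dX_X (R : idomainType) (n i : nat) : @dX R n i 'X = 0.
Proof.
apply/polyP => k; rewrite coef_map coefX coef0 /=.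
by case: eqP => _; rewrite ?mderiv0 // -mpolyC1 mderivC.
Qed.

Lemma dX_muX (R : idomainType) (n i j : nat) : (i < n.+1)%N -> (j < n.+1)%N ->
  @dX R n i (muX R n j) = (i == j)%:R.
Proof.
move=> lt_i lt_j; rewrite (derivation_dX R n i).1 dX_X addr0 /dX map_polyC /=.
by rewrite mderiv_var (inj_eq (@lshift_inj _ _)) -val_eqE /= !inordK // rmorph_nat.
Qed.

Lemma dX_polQ (R : idomainType) (n i j : nat) : @dX R n i (polQ R n j) = 0.
Proof. by rewrite /dX map_polyC /= mderiv_var eq_lrshift. Qed.

(* For [i = n], [inord n.+1] is out of range and takes the default value 0. *)
Lemma inord_ordS (n : nat) (i : 'I_n.+1) : inord i.+1 = ordS i.
Proof.
apply: val_inj => /=; have := ltn_ord i; rewrite leq_eqVlt => /predU1P[->|lt_i].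
  by rewrite modnn /inord /insubd insubN //= ltnn.
by rewrite inordK // modn_small.
Qed.

Lemma Smu_prod (R : idomainType) (n : nat) :
  Smu R n.+1 = \prod_(0 <= i < n.+1) muX R n i.
Proof.
by rewrite big_mkord; apply: eq_bigr => i _; rewrite /muX inord_val.
Qed.

Lemma opDE (R : idomainType) (n : nat) (i : 'I_n.+1) p :
  opD i p = p + polQ R n i * @dX R n i (@dX R n i.+1 p).
Proof.
rewrite /opD /polQ /dX inord_ordS inord_val; congr (_ + _ * _).
by apply/polyP => k; rewrite !coef_map /= coef_map_id0 ?raddf0.
Qed.

Lemma QS_continuant (R : idomainType) (n : nat) :
  QS R n.+2 = cyclic_continuant
    (fun i => varX R (inord i : 'I_n.+2)) (fun i => varQ R (inord i : 'I_n.+2)) n.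
Proof.
rewrite -[RHS](foldl_prod_cyclic_continuant (x := muX R n.+1)
  (q := polQ R n.+1) (d := @dX R n.+1)); last first.
(* This is [d_cyclic]: n+2 is out of range for [inord], and its default value 0 is the cyclic
   successor of the last index. *)
- move=> p; rewrite /dX (inord_ordS ord_max).
  congr (map_poly (mderiv (lshift _ _)) p).
  by apply: val_inj; rewrite /= modnn inordK.
- exact: dX_polQ.
- exact: dX_muX.
- exact: derivation_dX.
rewrite -val_enum_ord /QS Smu_prod.
elim: (enum _) (\prod_(_ <= _ < _) _) => // i s IHs p.
by rewrite [LHS]/= opDE IHs.
Qed.

(** This lets a sum over the powers of mu up to n+2 capture all of [QS]. *)
Lemma size_QS (R : idomainType) (n : nat) : (size (QS R n.+2) <= n.+3)%N.
Proof.
have sx i : (size (muX R n.+1 i) <= 2)%N by rewrite /muX addrC size_XaddC.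
have sq i : (size (polQ R n.+1 i) <= 1)%N by exact: size_polyC_leq1.
rewrite QS_continuant; apply: leq_trans (size_polyD _ _) _.
rewrite geq_max size_continuant //=; apply: leq_trans (size_polyMleq _ _) _.
have /= := leq_add (sq n.+1)
  (size_continuant n (fun i => sx i.+1) (fun i => sq i.+1)).
by rewrite /comp; case: (_ + _)%N => // k; lia.
Qed.

Lemma det_Lax (R : idomainType) (n : nat) :
  \det (map_mx polyC (Lax R n.+2) + 'X%:M) =
    map_poly (@inj R n.+2) (QS R n.+2)
    + (inj ((-1) ^+ n.+1 * \prod_(i < n.+2) varQ R i) / zvar R n.+2)%:P
    + (inj (-1) * zvar R n.+2)%:P.
Proof.
(* A bundled form of [inj], as [map_cyclic_continuant] requires a ring morphism. *)
pose f : {rmorphism {mpoly R[n.+2 + n.+2]} -> zfrac R n.+2} := @tofrac _ \o polyC.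
have injE : @inj R n.+2 =1 f by [].
have z0 : zvar R n.+2 != 0 by rewrite tofrac_eq0 polyX_eq0.
have fm1 : inj (-1) = -1 :> zfrac R n.+2 by rewrite injE rmorphN1.
have fA : inj ((-1) ^+ n.+1 * \prod_(i < n.+2) varQ R i) =
    (-1) ^+ n.+1 * \prod_(i < n.+2) f (varQ R (inord i)) :> zfrac R n.+2.
  rewrite injE rmorphM rmorphXn rmorphN1 rmorph_prod; congr (_ * _).
  by apply: eq_bigr => i _; rewrite inord_val.
rewrite fm1 fA QS_continuant (map_cyclic_continuant f).
have det_T := det_toda (fun i => f (varX R (inord i)))
  (fun i => f (varQ R (inord i))) n z0.
rewrite [X in map_mx _ X](_ : _ = Lax R n.+2) in det_T; first exact: det_T.
by apply/eq_mx => i j; rewrite inord_val.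
Qed.

(** * Uniqueness of the expansion in mu and z *)

Lemma map_poly_sum (S K : nzRingType) (f : S -> K) (p : {poly S}) n :
  f 0 = 0 -> (size p <= n)%N ->
  map_poly f p = \sum_(i < n) (f p`_i)%:P * 'X^i.
Proof.
move=> f0 sp; under eq_bigr do rewrite mul_polyC.
rewrite -(poly_def n (fun i => f p`_i)); apply/polyP => k.
rewrite coef_map_id0 // coef_poly; case: ltnP => // nk.
by rewrite nth_default // (leq_trans sp).
Qed.

Lemma coef_sum_ord (K : nzRingType) n (c : 'I_n -> K) (k : 'I_n) :
  (\sum_(i < n) (c i)%:P * 'X^i)`_k = c k.
Proof.
rewrite coef_sum (bigD1 k) //= coefCM coefXn eqxx mulr1 big1 ?addr0 // => i.
by rewrite -val_eqE /= coefCM coefXn eq_sym => /negPf->; rewrite mulr0.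
Qed.

Lemma coef_sum_ordDC (K : nzRingType) n (c : 'I_n -> K) (u v : K) (k : 'I_n) :
  (\sum_(i < n) (c i)%:P * 'X^i + u%:P + v%:P)`_k =
    if k == 0%N :> nat then c k + u + v else c k.
Proof.
by rewrite !coefD coef_sum_ord !coefC; case: eqP => // _; rewrite !addr0.
Qed.

(** Multiplying by z clears the denominator and leaves a + p z + b z^2; the coefficient of z gives
    p. *)
Lemma Laurent_coef0_inj (S : idomainType) (K : fieldType)
    (f : {rmorphism {poly S} -> K}) (p a b p' a' b' : S) :
  injective f ->
  f p%:P + f a%:P / f 'X + f b%:P * f 'X =
  f p'%:P + f a'%:P / f 'X + f b'%:P * f 'X -> p = p'.
Proof.
move=> f_inj; have X0 : f 'X != 0.
  by rewrite -(rmorph0 f) (inj_eq f_inj) polyX_eq0.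
have clear_denom (c d e : {poly S}) :
    (f c + f d / f 'X + f e * f 'X) * f 'X = f (c * 'X + d + e * 'X * 'X).
  by rewrite !rmorphD !rmorphM !mulrDl divfK.
move/(congr1 (fun r => r * f 'X)); rewrite !clear_denom => /f_inj/polyP/(_ 1%N).
by rewrite !coefD !coefMX !coefC /= !addr0.
Qed.

(** The terms in z and 1/z touch only the coefficient of mu^0; all others compare directly by
    injectivity. *)
Lemma Laurent_expansion_inj (S : idomainType) (K : fieldType)
    (f : {rmorphism {poly S} -> K}) n (c c' : 'I_n -> S) (a b a' b' : S) :
  injective f ->
  \sum_(i < n) (f (c i)%:P)%:P * 'X^i
    + (f a%:P / f 'X)%:P + (f b%:P * f 'X)%:P =
  \sum_(i < n) (f (c' i)%:P)%:P * 'X^i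
    + (f a'%:P / f 'X)%:P + (f b'%:P * f 'X)%:P ->
  c =1 c'.
Proof.
move=> f_inj E k; move/polyP/(_ k): E.
rewrite (coef_sum_ordDC (fun i => f (c i)%:P)).
rewrite (coef_sum_ordDC (fun i => f (c' i)%:P)).
case: ifP => _; first exact: Laurent_coef0_inj.
by move/f_inj/polyC_inj.
Qed.

Theorem theorem3p1 (R : idomainType) (n : nat) (hn : (2 <= n)%N) :
  (exists (P : 'I_n.+1 -> {mpoly R[n + n]}) (A B : {mpoly R[n + n]}),
     Lax_expansion P A B) /\
  (forall (P : 'I_n.+1 -> {mpoly R[n + n]}) (A B : {mpoly R[n + n]}),
     Lax_expansion P A B ->
     forall k : 'I_n.+1, (QS R n)`_k = P k).
Proof.
case: n hn => [|[|n]] // _.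
have inj0 : @inj R n.+2 0 = 0 by rewrite /inj polyC0 tofrac0.
have Lax_QS := det_Lax R n; rewrite (map_poly_sum inj0 (size_QS R n)) in Lax_QS.
(* The witnesses are the coefficients of [QS], the signed product of the Q_i, and -1. Uniqueness
   then transfers these coefficients to any other expansion. *)
split; first by do 3!eexists; exact: Lax_QS.
move=> P A B E k.
have tofrac_inj : injective (@tofrac {poly {mpoly R[n.+2 + n.+2]}}).
  by move=> p q /eqP; rewrite tofrac_eq => /eqP.
exact: (Laurent_expansion_inj tofrac_inj (etrans (esym Lax_QS) E) k).
Qed.
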